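(* Let $(A,B)$ be a globally rigid size-$r$ nonnegative factorization, where $A\in\mathbb{R}^{m\times r}_{\ge 0}$, $B\in\mathbb{R}^{r\times n}_{\ge 0}$ and $\operatorname{rank}(AB)=r$. Then all of the following hold: (i) the support of any column of $A$ is not contained in the support of any other column of $A$; (ii) the support of any row of $B$ is not contained in the support of any other row of $B$; (iii) the matrices $A$ and $B$ have at least $r^2-r+1$ zeros in total, or $\operatorname{K\text{-}rank}(Z_{(A,B)})<\min(c,r^2-r)$, where $c$ is the number of columns of $Z_{(A,B)}$.
   Context: Here $m,n,r$ are positive integers. The support of a vector is the set of positions of its nonzero entries. A size-$r$ nonnegative factorization of a matrix $M$ is a pair $(\tilde A,\tilde B)$ of entrywise nonnegative matrices with $\tilde A\tilde B=M$, where $\tilde A$ has $r$ columns and $\tilde B$ has $r$ rows. A size-$r$ nonnegative factorization $(A,B)$ is globally rigid if every size-$r$ nonnegative factorization of $AB$ is obtained by scaling and permuting the columns of $A$ and rows of $B$, i.e. is of the form $(AP,P^{-1}B)$ with $P$ the product of an $r\times r$ permutation matrix and a diagonal matrix with positive diagonal entries. Let $a_1^T,\dots,a_m^T$ be the rows of $A$ and $b_1,\dots,b_n$ the columns of $B$; let $S_i$, resp. $T_i$, $\subseteq\{1,\dots,r\}$ be the set of positions of zero entries of $a_i$, resp. $b_i$; let $e_j$ be the $j$th standard basis vector of $\mathbb{R}^r$; let $\mathcal{A}_i=\{a_ie_j^T : j\in S_i\}$ and $\mathcal{B}_i=\{-e_jb_i^T : j\in T_i\}$. $Z_{(A,B)}$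 is the matrix whose columns are the elements of $\mathcal{A}_1\cup\dots\cup\mathcal{A}_m\cup\mathcal{B}_1\cup\dots\cup\mathcal{B}_n$, regarded as vectors in $\mathbb{R}^{r^2}$. The Kruskal rank $\operatorname{K\text{-}rank}(Z)$ of a matrix $Z$ is the maximal $k$ such that any $k$ columns of $Z$ are linearly independent.
   Formalization: The formal statement assumes r ≥ 2 instead of r ≥ 1: for r = 1 claim (iii) is false, e.g. A = B = (1) is globally rigid of rank 1, has no zeros, and K-rank < min(0,0) is impossible; (i) and (ii) are vacuous for r = 1. *)

(* Defs.v *)
From HB Require Import structures.
From mathcomp Require Import all_boot all_order all_fingroup all_algebra.
From mathcomp Require Import reals.

Set Implicit Arguments.
Unset Strict Implicit.
Unset Printing Implicit Defensive.
Import Order.TTheory GRing.Theory Num.Theory.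
Local Open Scope ring_scope.

Definition nonneg_factorization (R : realFieldType) (m r n : nat)
    (M : 'M[R]_(m, n)) (A : 'M[R]_(m, r)) (B : 'M[R]_(r, n)) : Prop :=
  [/\ A \is a mxOver Num.nneg, B \is a mxOver Num.nneg & A *m B = M].

Definition globally_rigid (R : realFieldType) (m r n : nat)
    (A : 'M[R]_(m, r)) (B : 'M[R]_(r, n)) : Prop :=
  nonneg_factorization (A *m B) A B /\
  forall (A' : 'M[R]_(m, r)) (B' : 'M[R]_(r, n)),
    nonneg_factorization (A *m B) A' B' ->
    exists (s : 'S_r) (d : 'rV[R]_r),
      let P := perm_mx s *m diag_mx d in
      [/\ forall j, 0 < d 0 j, A' = A *m P & B' = invmx P *m B].

Definition num_zeros (R : realFieldType) (p q : nat) (M : 'M[R]_(p, q)) : nat :=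
  #|[set ij : 'I_p * 'I_q | M ij.1 ij.2 == 0]|.

(* [calA A i] lists the [a_i e_j^T], where [a_i] is the transposed [i]-th row
   of [A] and [j] runs over the zero positions of [a_i]; [calB B i] lists the
   [- e_j b_i^T], where [b_i] is the [i]-th column of [B] and [j] runs over the
   zero positions of [b_i]. *)
Definition calA (R : realFieldType) (m r : nat) (A : 'M[R]_(m, r)) (i : 'I_m) :
    seq 'M[R]_r :=
  [seq (row i A)^T *m delta_mx (0 : 'I_1) j | j in [set j | A i j == 0]].

Definition calB (R : realFieldType) (r n : nat) (B : 'M[R]_(r, n)) (i : 'I_n) :
    seq 'M[R]_r :=
  [seq - (delta_mx j (0 : 'I_1) *m (col i B)^T) | j in [set j | B j i == 0]].

(* The columns of Z form a union of sets, so repeated elements are kept only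
   once: hence [undup]. *)
Definition Zelts (R : realFieldType) (m r n : nat)
    (A : 'M[R]_(m, r)) (B : 'M[R]_(r, n)) : seq 'M[R]_r :=
  undup (flatten [seq calA A i | i : 'I_m] ++ flatten [seq calB B i | i : 'I_n]).

Definition Zmx (R : realFieldType) (m r n : nat)
    (A : 'M[R]_(m, r)) (B : 'M[R]_(r, n)) : 'M[R]_(r * r, size (Zelts A B)) :=
  \matrix_(p, k) mxvec (Zelts A B)`_k 0 p.

(* The maximum is over k <= c, with c the number of columns: beyond c the
   condition on k-subsets of columns holds vacuously. *)
Definition kruskal_rank (R : realFieldType) (p c : nat) (Z : 'M[R]_(p, c)) : nat :=
  \max_(k < c.+1 | [forall J : {set 'I_c},
                      (#|J| == k) ==> free [seq col j Z | j in J]]) k.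

(* Main.v *)
Require Import Defs.
From HB Require Import structures.
From mathcomp Require Import all_boot all_order all_fingroup all_algebra.
From mathcomp Require Import reals filter topology normedtype derive.

Set Implicit Arguments.
Unset Strict Implicit.
Unset Printing Implicit Defensive.
Import Order.TTheory GRing.Theory Num.Theory.
Import numFieldNormedType.Exports.
Local Open Scope ring_scope.
Local Open Scope classical_set_scope.

(** Every invertible [G] with [A *m G] and [invmx G *m B] nonnegative yields
    another nonnegative factorization of [A *m B]. Since [A *m B] has rank [r],
    [A] has a left inverse, so global rigidity forces such a [G] to be monomial
    (a permutation times a positive diagonal matrix). Apply this to
    [G = 1%:M + t *: X] for small [t > 0]: as [G] is close to the identity, its
    diagonal does not vanish, so [G], hence [X], is diagonal. Thus a
    non-diagonal direction [X] along which both factors stay nonnegative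
    contradicts rigidity ([rigid_direction_diag]), and each of the three claims
    follows by exhibiting such an [X].

    If the support of column [j] of [A] lies in that of column [k], take
    [X = - delta_mx j k]: a small multiple of column [j] is subtracted from
    column [k] of [A], while a multiple of row [k] of [B] is added to row [j].
    For the rows of [B] take [X = delta_mx k j].

    For the last claim, suppose that there are at most [r ^ 2 - r] zeros and
    that the Kruskal rank is not smaller than the minimum. The matrix [Z] has
    at most as many columns as there are zeros, so all its columns are linearly
    independent. The inner products of [X] with these columns are the entries
    of [A *m X] and [- (X *m B)] at the zero positions of [A] and [B], so
    independence lets us prescribe all of them to be [1]
    ([row_free_strict_direction]). Then both factors move strictly inside the
    nonnegative orthant to first order, so [X] is such a direction and must be
    diagonal. But a diagonal [X] keeps the zeros of [A], whereas [A *m X] is [1]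
    there; and [A] has a zero, because the first claim forbids any column to
    have full support. *)

(** * Rigidity and changes of basis *)

(** Monomiality is recorded only as uniqueness of the nonzero entry in a row,
    the form in which it excludes off-diagonal entries once the diagonal is
    known not to vanish. *)
Lemma rigid_gauge_row (R : realFieldType) (m n r : nat)
    (A : 'M[R]_(m, r)) (B : 'M[R]_(r, n)) (G : 'M[R]_r) :
  globally_rigid A B -> \rank (A *m B) = r -> G \in unitmx ->
  A *m G \is a mxOver Num.nneg -> invmx G *m B \is a mxOver Num.nneg ->
  forall i j k, G i j != 0 -> G i k != 0 -> j = k.
Proof.
move=> [_ rigid] rkAB Gu AG_ge0 GB_ge0.
have [|s [d [_ AGE _]]] := rigid (A *m G) (invmx G *m B).
  by split=> //; rewrite mulmxA mulmxK.
have /row_fullP[L LA] : row_full A.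
  by rewrite /row_full eqn_leq rank_leq_col -{1}rkAB mxrankM_maxl.
have -> : G = perm_mx s *m diag_mx d.
  by rewrite -[LHS]mul1mx -[RHS]mul1mx -LA -!mulmxA AGE.
have entry i j : (perm_mx s *m diag_mx d) i j != 0 -> j = s i.
  by rewrite mul_mx_diag !mxE; case: (s i =P j) => // _; rewrite mul0r eqxx.
by move=> i j k /entry-> /entry->.
Qed.

(** * Factorizations near the given one *)

Lemma near_poly_gt0 (R : realType) (p : {poly R}) :
  0 < p.[0] -> \forall t \near 0^'+, 0 < p.[t].
Proof.
move=> p0; have cvgp : p.[t] @[t --> 0^'+] --> p.[0].
  by apply: cvg_at_right_filter; exact: continuous_horner.
exact: (cvgr_gt _ cvgp).
Qed.

(** Positive entries of [M] survive small perturbations by continuity, so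
    the sign of [N] matters only where [M] vanishes. *)
Lemma near_add_scale_nneg (R : realType) (p q : nat) (M N : 'M[R]_(p, q)) :
  M \is a mxOver Num.nneg -> (forall i j, M i j = 0 -> 0 <= N i j) ->
  \forall t \near 0^'+, M + t *: N \is a mxOver Num.nneg.
Proof.
move=> /mxOverP M_ge0 N_ge0.
suff : \forall t \near 0^'+, forall i j, 0 <= M i j + t * N i j.
  by apply: filterS => t MN; apply/mxOverP => i j; rewrite !mxE nnegrE.
apply: filter_forall => i; apply: filter_forall => j.
have [M0|Mn0] := eqVneq (M i j) 0.
  near=> t; rewrite M0 add0r; apply: mulr_ge0; last exact: N_ge0.
  by apply: ltW; near: t; exact: nbhs_right_gt.
have := @near_poly_gt0 R ((M i j)%:P + N i j *: 'X).
rewrite !hornerE lt_def Mn0 -nnegrE M_ge0 => /(_ isT); apply: filterS => t.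
by rewrite !hornerE mulrC => /ltW.
Unshelve. all: by end_near.
Qed.

(** Treating [t] as a polynomial variable makes the determinant and the
    adjugate of [1%:M + t *: X] polynomial in [t], hence continuous. *)
Lemma horner_one_add_scale (R : comNzRingType) (r : nat) (X : 'M[R]_r) (t : R) :
  map_mx (horner_eval t) (1%:M + 'X *: map_mx polyC X) = 1%:M + t *: X.
Proof.
rewrite map_mxD map_mx1 map_mxZ /= [horner_eval t 'X]hornerX -map_mx_comp.
by congr (_ + _ *: _); apply/matrixP => i j; rewrite !mxE /= [LHS]hornerC.
Qed.

Lemma near_det_gt0 (R : realType) (r : nat) (X : 'M[R]_r) :
  \forall t \near 0^'+, 0 < \det (1%:M + t *: X).
Proof.
pose p := \det (1%:M + 'X *: map_mx polyC X).
have pE t : p.[t] = \det (1%:M + t *: X).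
  by rewrite -horner_one_add_scale det_map_mx.
have := @near_poly_gt0 R p; rewrite pE scale0r addr0 det1 => /(_ ltr01).
by apply: filterS => t; rewrite pE.
Qed.

(** For small [t > 0] the diagonal of [1%:M + t *: X] is positive; rigidity
    allows one nonzero entry per row, so the off-diagonal entries [t * X j k]
    vanish. *)
Lemma rigid_direction_diag (R : realType) (m n r : nat)
    (A : 'M[R]_(m, r)) (B : 'M[R]_(r, n)) (X : 'M[R]_r) :
  globally_rigid A B -> \rank (A *m B) = r ->
  (\forall t \near 0^'+, A + t *: (A *m X) \is a mxOver Num.nneg) ->
  (\forall t \near 0^'+, invmx (1%:M + t *: X) *m B \is a mxOver Num.nneg) ->
  forall j k, j != k -> X j k = 0.
Proof.
move=> rigid rkAB nearA nearB j k jk; apply/eqP/negPn/negP => Xjk.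
have nearX : \forall t \near 0^'+, 0 < 1 + t * X j j.
  have := @near_poly_gt0 R (1 + X j j *: 'X).
  rewrite !hornerE => /(_ ltr01); apply: filterS => t.
  by rewrite !hornerE mulrC.
near (0 : R)^'+ => t.
have t_gt0 : 0 < t by near: t; exact: nbhs_right_gt.
have Gu : 1%:M + t *: X \in unitmx.
  by rewrite unitmxE unitfE gt_eqF //; near: t; exact: near_det_gt0.
move/eqP: (jk); apply.
apply: (rigid_gauge_row rigid rkAB Gu _ _ (i := j)).
- by rewrite mulmxDr mulmx1 -scalemxAr; near: t.
- by near: t.
- by rewrite !mxE eqxx gt_eqF //; near: t.
- by rewrite !mxE (negPf jk) add0r mulf_neq0 // gt_eqF.
Unshelve. all: by end_near.
Qed.

(** * Inclusions of supports *)

Lemma invmx_one_add_sqr0 (R : fieldType) (r : nat) (X : 'M[R]_r) (t : R) :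
  X *m X = 0 -> invmx (1%:M + t *: X) = 1%:M - t *: X.
Proof.
move=> XX; have GV : (1%:M + t *: X) *m (1%:M - t *: X) = 1%:M.
  rewrite mulmxDl mul1mx mulmxBr mulmx1 -scalemxAl -scalemxAr XX !scaler0.
  by rewrite subr0 addrNK.
by have [Gu _] := mulmx1_unit GV; rewrite -[RHS](mulKmx Gu) GV mulmx1.
Qed.

(** With [X = c *: delta_mx j k] the change of basis adds [t * c] times
    column [j] of [A] to column [k] and, because [X] squares to zero, subtracts
    [t * c] times row [k] of [B] from row [j]. The two hypotheses say that these
    moves create no negative entry, which rigidity excludes. *)
Lemma rigid_no_transvection (R : realType) (m n r : nat)
    (A : 'M[R]_(m, r)) (B : 'M[R]_(r, n)) (j k : 'I_r) (c : R) :
  globally_rigid A B -> \rank (A *m B) = r -> j != k -> c != 0 ->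
  (forall i, A i k = 0 -> 0 <= c * A i j) ->
  ~ (forall i, B j i = 0 -> c * B k i <= 0).
Proof.
move=> rigid rkAB jk c0 Ajk Bjk; have [[A_ge0 B_ge0 _] _] := rigid.
pose X : 'M[R]_r := c *: delta_mx j k.
have XX : X *m X = 0.
  by rewrite -scalemxAl -scalemxAr mul_delta_mx_0 1?eq_sym // !scaler0.
have AX i l : (A *m X) i l = c * A i j *+ (l == k).
  rewrite -scalemxAr !mxE (bigD1 j) //= big1 => [|h /negPf hj].
    by rewrite !mxE eqxx addr0 /= mulr_natr mulrnAr.
  by rewrite !mxE hj mulr0.
have XB h i : (X *m B) h i = c * B k i *+ (h == j).
  rewrite -scalemxAl !mxE (bigD1 k) //= big1 => [|l /negPf lk].
    by rewrite !mxE eqxx addr0 andbT mulr_natl mulrnAr.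
  by rewrite !mxE lk andbF mul0r.
have /eqP : X j k = 0.
  apply: (rigid_direction_diag rigid rkAB) (jk).
    apply: near_add_scale_nneg => // i l.
    by rewrite AX; have [-> /Ajk|] := eqVneq l k.
  have : \forall t \near 0^'+, B + t *: - (X *m B) \is a mxOver Num.nneg.
    apply: near_add_scale_nneg => // h i; rewrite mxE oppr_ge0 XB.
    by have [-> /Bjk|] := eqVneq h j.
  apply: filterS => t; rewrite invmx_one_add_sqr0 // mulmxBl mul1mx.
  by rewrite -(scalemxAl t X) scalerN.
by rewrite !mxE !eqxx mulr1 (negPf c0).
Qed.

Lemma rigid_col_support (R : realType) (m n r : nat)
    (A : 'M[R]_(m, r)) (B : 'M[R]_(r, n)) (j k : 'I_r) :
  globally_rigid A B -> \rank (A *m B) = r -> j != k ->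
  ~~ (support (fun i => A i j) \subset support (fun i => A i k)).
Proof.
move=> rigid rkAB jk; have [[_ /mxOverP B_ge0 _] _] := rigid.
apply/negP => /subsetP sub.
apply: (rigid_no_transvection (c := -1) rigid rkAB jk).
- by rewrite oppr_eq0 oner_eq0.
- move=> i Aik; have [->|Aij] := eqVneq (A i j) 0; first by rewrite mulr0.
  by have /eqP := sub i Aij.
- by move=> i _; rewrite mulN1r oppr_le0 -nnegrE B_ge0.
Qed.

Lemma rigid_row_support (R : realType) (m n r : nat)
    (A : 'M[R]_(m, r)) (B : 'M[R]_(r, n)) (j k : 'I_r) :
  globally_rigid A B -> \rank (A *m B) = r -> j != k ->
  ~~ (support (fun i => B j i) \subset support (fun i => B k i)).
Proof.
move=> rigid rkAB jk; have [[/mxOverP A_ge0 _ _] _] := rigid.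
apply/negP => /subsetP sub; rewrite eq_sym in jk.
apply: (rigid_no_transvection (c := 1) rigid rkAB jk); first exact: oner_neq0.
- by move=> i _; rewrite mul1r -nnegrE A_ge0.
- move=> i Bki; have [->|Bji] := eqVneq (B j i) 0; first by rewrite mulr0.
  by have /eqP := sub i Bji.
Qed.

(** * Linear independence of the zero constraints *)

(** To first order [invmx (1%:M + t *: X) *m B] is [B - t *: (X *m B)]. The
    argument avoids expanding the inverse: with [N t] the adjugate of
    [1%:M + t *: X] times [B], the sign of the entries is that of [N t], and
    [(1%:M + t *: X) *m N t = \det (1%:M + t *: X) *: B]. Where [B] vanishes
    this reads [N t = - t *: (X *m N t)], whose sign for small [t] is governed by
    [X *m N 0 = X *m B]. *)
Lemma near_invmx_mul_nneg (R : realType) (n r : nat)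
    (X : 'M[R]_r) (B : 'M[R]_(r, n)) :
  B \is a mxOver Num.nneg -> (forall i j, B i j = 0 -> (X *m B) i j < 0) ->
  \forall t \near 0^'+, invmx (1%:M + t *: X) *m B \is a mxOver Num.nneg.
Proof.
move=> /mxOverP B_ge0 XB.
pose N t := \adj (1%:M + t *: X) *m B.
pose P : 'M[{poly R}]_(r, n) :=
  \adj (1%:M + 'X *: map_mx polyC X) *m map_mx polyC B.
have horner_polyC_mx p q (M : 'M[R]_(p, q)) t :
    map_mx (horner_eval t) (map_mx polyC M) = M.
  by apply/matrixP => i j; rewrite !mxE [LHS]hornerC.
have PE t : map_mx (horner_eval t) P = N t.
  by rewrite map_mxM map_mx_adj horner_one_add_scale horner_polyC_mx.
have N0 : N 0 = B.
  by rewrite /N scale0r addr0 -[\adj _]mul1mx mul_mx_adj det1 mul1mx.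
have near_gt0 (Q : 'M[{poly R}]_(r, n)) i j :
    0 < map_mx (horner_eval 0) Q i j ->
    \forall t \near 0^'+, 0 < map_mx (horner_eval t) Q i j.
  rewrite mxE => /near_poly_gt0; apply: filterS => t; by rewrite mxE.
have NE t i j : N t i j = \det (1%:M + t *: X) * B i j - t * (X *m N t) i j.
  have : (1%:M + t *: X) *m N t = \det (1%:M + t *: X) *: B.
    by rewrite mulmxA mul_mx_adj mul_scalar_mx.
  rewrite mulmxDl mul1mx -scalemxAl => /matrixP/(_ i j).
  by rewrite !mxE => <-; rewrite addrK.
have nearN : \forall t \near 0^'+, forall i j, 0 <= N t i j.
  apply: filter_forall => i; apply: filter_forall => j.
  have [B0|Bn0] := eqVneq (B i j) 0.
    have : \forall t \near 0^'+, 0 < - (X *m N t) i j.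
      have := near_gt0 (- (map_mx polyC X *m P)) i j.
      have QE t : map_mx (horner_eval t) (- (map_mx polyC X *m P)) i j
                  = - (X *m N t) i j.
        by rewrite map_mxN map_mxM horner_polyC_mx PE mxE.
      rewrite QE N0 oppr_gt0 => /(_ (XB _ _ B0)).
      by apply: filterS => t; rewrite QE.
    move=> nearXN; near=> t; rewrite NE B0 mulr0 add0r -mulrN ltW //.
    by apply: mulr_gt0; near: t; first exact: nbhs_right_gt.
  have := near_gt0 P i j; rewrite PE N0 lt_def Bn0 -nnegrE B_ge0 => /(_ isT).
  by apply: filterS => t; rewrite PE => /ltW.
near=> t; have det_gt0 : 0 < \det (1%:M + t *: X).
  by near: t; exact: near_det_gt0.
have N_ge0 : forall i j, 0 <= N t i j by near: t.
have Gu : 1%:M + t *: X \in unitmx by rewrite unitmxE unitfE gt_eqF.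
apply/mxOverP => i j; rewrite /invmx Gu -scalemxAl mxE nnegrE.
by rewrite mulr_ge0 // invr_ge0 ltW.
Unshelve. all: by end_near.
Qed.

Lemma row_free_tr_cols (R : fieldType) (p c : nat) (Z : 'M[R]_(p, c)) :
  free [seq col j Z | j in [set: 'I_c]] -> row_free Z^T.
Proof.
have -> : [seq col j Z | j in [set: 'I_c]] = [tuple col j Z | j < c].
  by rewrite /= /image_mem enum_setT enumT.
move=> /freeP Zfree; apply: inj_row_free => v vZ.
apply/rowP => k; rewrite mxE; apply: (Zfree (fun i => v 0 i)) => {k}.
rewrite -[RHS]trmx0 -vZ mulmx_sum_row linear_sum; apply: eq_bigr => i _.
by rewrite -tnth_nth tnth_mktuple /= linearZ /= -tr_col trmxK.
Qed.

(** The maximum defining the Kruskal rank runs over [k <= c], so reaching [c]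
    means that [k = c] itself is admissible, and the only set of [c] columns is
    the set of all of them. *)
Lemma kruskal_rank_full (R : realFieldType) (p c : nat) (Z : 'M[R]_(p, c)) :
  (0 < c)%N -> (c <= kruskal_rank Z)%N -> row_free Z^T.
Proof.
case: c Z => // c Z _; case: (boolP (row_free Z^T)) => // Zdep.
rewrite leqNgt ltnS => /negP[]; apply/bigmax_leqP => k /forallP indep.
rewrite -ltnS ltn_neqAle -ltnS ltn_ord andbT.
apply: contra Zdep => /eqP kE; apply: row_free_tr_cols.
by have := indep [set: 'I_c.+1]; rewrite cardsT card_ord kE eqxx.
Qed.

(** Each zero contributes one matrix to the list, and removing repetitions can
    only shorten it. *)
Lemma size_Zelts (R : realFieldType) (m n r : nat)
    (A : 'M[R]_(m, r)) (B : 'M[R]_(r, n)) :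
  (size (Zelts A B) <= num_zeros A + num_zeros B)%N.
Proof.
have size_image_flatten (I : finType) (s : I -> seq 'M[R]_r) :
    size (flatten [seq s i | i : I]) = (\sum_i size (s i))%N.
  by rewrite size_flatten /shape -map_comp sumnE big_map enumT.
have card_pair p q (P : 'I_p -> 'I_q -> bool) :
    #|[set ij : 'I_p * 'I_q | P ij.1 ij.2]| = (\sum_i #|[set j | P i j]|)%N.
  rewrite -sum1dep_card -(pair_big_dep xpredT P (fun _ _ => 1%N)) /=.
  by apply: eq_bigr => i _; rewrite sum1dep_card.
apply: (leq_trans (size_undup _)); rewrite size_cat !size_image_flatten.
apply: leq_add; apply/eq_leq/esym.
  rewrite /num_zeros (card_pair _ _ (fun i j => A i j == 0)).
  by apply: eq_bigr => i _; rewrite size_map -cardE.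
rewrite /num_zeros (card_pair _ _ (fun j i => B j i == 0)).
under eq_bigr do rewrite -sum1dep_card.
rewrite (exchange_big_dep xpredT) //=; apply: eq_bigr => i _.
by rewrite size_map -cardE sum1dep_card.
Qed.

Lemma calA_mem (R : realFieldType) (m n r : nat)
    (A : 'M[R]_(m, r)) (B : 'M[R]_(r, n)) i j :
  A i j = 0 -> (row i A)^T *m delta_mx (0 : 'I_1) j \in Zelts A B.
Proof.
move=> A0; rewrite mem_undup mem_cat; apply/orP; left.
apply/flattenP; exists (calA A i); first by apply: image_f.
by apply/imageP; exists j; rewrite ?inE ?A0.
Qed.

Lemma calB_mem (R : realFieldType) (m n r : nat)
    (A : 'M[R]_(m, r)) (B : 'M[R]_(r, n)) i j :
  B j i = 0 -> - (delta_mx j (0 : 'I_1) *m (col i B)^T) \in Zelts A B.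
Proof.
move=> B0; rewrite mem_undup mem_cat; apply/orP; right.
apply/flattenP; exists (calB B i); first by apply: image_f.
by apply/imageP; exists j; rewrite ?inE ?B0.
Qed.

(** The inner product of [X] with [a_i e_j^T] is [(A *m X) i j] and that with
    [- e_j b_i^T] is [- (X *m B) j i]. A right inverse of the transpose of [Z]
    provides an [X] whose inner product with every column of [Z] is [1]. *)
Lemma row_free_strict_direction (R : realFieldType) (m n r : nat)
    (A : 'M[R]_(m, r)) (B : 'M[R]_(r, n)) :
  row_free (Zmx A B)^T ->
  exists X : 'M[R]_r, (forall i j, A i j = 0 -> (A *m X) i j = 1) /\
                      (forall i j, B i j = 0 -> (X *m B) i j = -1).
Proof.
move=> /row_freeP[W ZW].
pose X := vec_mx (W *m const_mx 1 : 'cV[R]_(r * r))^T; exists X.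
have ZX z : z \in Zelts A B -> (mxvec z *m (mxvec X)^T) 0 0 = 1.
  move=> zZ; have zlt : (index z (Zelts A B) < size (Zelts A B))%N.
    by rewrite index_mem.
  have -> : mxvec z = row (Ordinal zlt) (Zmx A B)^T.
    by apply/rowP => p; rewrite !mxE /= nth_index.
  by rewrite /X vec_mxK trmxK -row_mul mulmxA ZW mul1mx !mxE.
split=> i j ij0.
  have := ZX _ (calA_mem B ij0); rewrite mxvec_dotmul trmx_delta -row_mul -colE.
  by rewrite !mxE.
have := ZX _ (calB_mem A ij0); rewrite linearN mulNmx /= -trmx_delta.
rewrite mxvec_dotmul trmxK -rowE -row_mul colE mulmxA -colE => <-.
by rewrite !mxE opprK.
Qed.

Theorem corollary4p10 (R : realType) (m n r : nat)
    (hm : (0 < m)%N) (hn : (0 < n)%N) (hr : (1 < r)%N)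
    (A : 'M[R]_(m, r)) (B : 'M[R]_(r, n))
    (hrigid : globally_rigid A B) (hrank : \rank (A *m B) = r) :
  [/\ forall j k : 'I_r, j != k ->
        ~~ (support (fun i => A i j) \subset support (fun i => A i k)),
      forall j k : 'I_r, j != k ->
        ~~ (support (fun i => B j i) \subset support (fun i => B k i))
    & (r ^ 2 - r + 1 <= num_zeros A + num_zeros B)%N \/
      (kruskal_rank (Zmx A B) < minn (size (Zelts A B)) (r ^ 2 - r))%N].
Proof.
split=> [j k jk|j k jk|]; first exact: (rigid_col_support hrigid hrank).
  exact: (rigid_row_support hrigid hrank).
have [many|few] := leqP (r ^ 2 - r + 1) (num_zeros A + num_zeros B).
  by left.
right; have size_le : (size (Zelts A B) <= r ^ 2 - r)%N.
  by apply: leq_trans (size_Zelts A B) _; rewrite addn1 in few.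
rewrite (minn_idPl size_le) ltnNge; apply/negP => Kfull.
have [[A_ge0 B_ge0 _] _] := hrigid.
(* Two distinct columns suffice to locate a zero of A, by the first claim. *)
pose j : 'I_r := Ordinal (ltnW hr); pose k : 'I_r := Ordinal hr.
have jk : j != k by [].
have /subsetPn[i Aij] := rigid_col_support hrigid hrank jk.
rewrite inE negbK => /eqP Aik.
have Zpos : (0 < size (Zelts A B))%N.
  by have := calA_mem B Aik; case: (Zelts A B).
have [X [AX XB]] := row_free_strict_direction (kruskal_rank_full Zpos Kfull).
(* X is diagonal, so column k of A *m X is a multiple of column k of A, and
   cannot be 1 where the latter is 0. *)
have Xdiag : forall h l, h != l -> X h l = 0.
  apply: (rigid_direction_diag hrigid hrank).
    by apply: near_add_scale_nneg => // h l /AX->.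
  by apply: near_invmx_mul_nneg => // h l /XB->; rewrite ltrN10.
have /esym/eqP : (A *m X) i k = 1 by exact: AX.
rewrite mxE big1 ?oner_eq0 // => l _.
by have [->|/Xdiag->] := eqVneq l k; rewrite ?Aik ?mul0r ?mulr0.
Qed.
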